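(* Let $p,q$ be positive integers and let $n$ be an integer. If $n\ge p+q+\left\lfloor\frac{q}{p}\right\rfloor$, then $$\nu_{n;p,n-q}\ge\binom{p+q+\left\lfloor q/p\right\rfloor}{p}.$$
   Context: Let $[n]=\{1,2,\dots,n\}$. For integers $0\le \ell\le u\le n$, let $\mathcal P_{n;\ell,u}=\{X\subseteq [n]: \ell\le |X|\le u\}$, ordered by inclusion. A maximal interval in $\mathcal P_{n;\ell,u}$ is a set of the form $[A,B]=\{X\subseteq[n]: A\subseteq X\subseteq B\}$ with $A\subseteq B\subseteq [n]$, $|A|=\ell$ and $|B|=u$. The number $\nu_{n;\ell,u}$ denotes the maximum number of pairwise disjoint maximal intervals in $\mathcal P_{n;\ell,u}$ (disjoint as families of subsets of $[n]$). *)

(* Defs.v *)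
From mathcomp Require Import all_boot.
Set Implicit Arguments.
Unset Strict Implicit.
Unset Printing Implicit Defensive.

(* The ground set {1, ..., n} is represented by 'I_n. *)
Definition truncated_boolean (n l u : nat) : {set {set 'I_n}} :=
  [set X : {set 'I_n} | l <= #|X| <= u].

Definition set_interval (n : nat) (A B : {set 'I_n}) : {set {set 'I_n}} :=
  [set X : {set 'I_n} | (A \subset X) && (X \subset B)].

Definition maximal_intervals (n l u : nat) : {set {set {set 'I_n}}} :=
  [set I : {set {set 'I_n}} |
    [exists A : {set 'I_n}, exists B : {set 'I_n},
      [&& A \subset B, #|A| == l, #|B| == u & I == set_interval A B]]].

Lemma maximal_interval_sub n l u (I : {set {set 'I_n}}) :
  I \in maximal_intervals n l u -> I \subset truncated_boolean n l u.
Proof.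
rewrite inE => /existsP[A /existsP[B /and4P[_ /eqP <- /eqP <- /eqP ->]]].
apply/subsetP=> X; rewrite !inE => /andP[sAX sXB].
by rewrite !subset_leq_card.
Qed.

(* Maximal intervals are nonempty, so disjoint ones are distinct: taking sets
   of intervals rather than indexed families does not change the maximum. *)
Definition nu (n l u : nat) : nat :=
  \max_(F : {set {set {set 'I_n}}} |
         (F \subset maximal_intervals n l u) && trivIset F) #|F|.

(* Main.v *)
Require Import Defs.
From mathcomp Require Import all_boot.
From mathcomp Require Import zify.

(** Write k = q %/ p and m = p + q + k.  Two intervals [A, B] and [A', B'] meet
    exactly when A is contained in B' and A' in B, so it suffices to attach to
    every p-subset A of the first m points a set E(A) of k further points among
    them, such that distinct A, A' never satisfy both A :\: A' \subset E(A')
    and A' :\: A \subset E(A).  The upper end of the interval of A is then A,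
    together with E(A) and all points from m on; it has p + k + (n - m) = n - q
    elements.

    The choice of E(A) is a k-fold parenthesis matching.  Read the points from
    left to right; a point of A opens k brackets, any other point closes one
    open bracket if there is one, and is called free otherwise.  At most k * p
    points close a bracket, so at least m - p - k * p >= k points are free
    ([sum_free]); E(A) consists of the last k free points.

    Suppose that A <> A' violate the requirement.  Both differences are
    nonempty, so up to exchanging A and A' there are e in A' :\: A and x in
    A :\: A' with e < x, and they can be taken consecutive in the symmetric
    difference.  For A, the point e is free, so no bracket is open after it; for
    A', at least k brackets are open after e.  Between e and x both sets agree,
    so the surplus of k open brackets of A' over A only shrinks at points that
    are free for A ([backlog_surplus]).  Those points lie after e in E(A), so
    there are at most k - 1 of them, and A' still has an open bracket at x.
    Hence x is not free for A', although it belongs to E(A')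
    ([no_crossing]). *)

(** * Reduction to a choice of upper ends *)

Lemma mem_set_interval n (A B X : {set 'I_n}) :
  (X \in set_interval A B) = (A \subset X) && (X \subset B).
Proof. by rewrite inE. Qed.

(** Intersecting intervals [A, B A] and [A', B A'] share A :|: A', so that each
    lower end lies below the other upper end; excluding this for A != A' makes
    the intervals disjoint, and the lower ends index them faithfully. *)
Lemma card_le_nu (n l u : nat) (S : {set {set 'I_n}}) (B : {set 'I_n} -> {set 'I_n}) :
    {in S, forall A : {set 'I_n}, [/\ A \subset B A, #|A| = l & #|B A| = u]} ->
    {in S &, forall A A' : {set 'I_n}, A \subset B A' -> A' \subset B A -> A = A'} ->
  #|S| <= nu n l u.
Proof.
move=> SB inj.
pose I A := set_interval A (B A).
have memI A : A \in S -> A \in I A.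
  by move=> /SB[sAB _ _]; rewrite mem_set_interval subxx.
have meet A A' X : A \in S -> A' \in S -> X \in I A -> X \in I A' -> A = A'.
  move=> SA SA'; rewrite !mem_set_interval => /andP[AX XB] /andP[A'X XB'].
  by apply: inj => //; [apply: subset_trans AX XB' | apply: subset_trans A'X XB].
have injI : {in S &, injective I}.
  move=> A A' SA SA' eqI; apply: (meet A A' A) => //; first exact: memI.
  by rewrite -eqI; apply: memI.
rewrite -(card_in_imset injI) /nu.
apply: (bigmax_sup (I @: S)) => //; apply/andP; split.
  apply/subsetP=> _ /imsetP[A SA ->]; have [sAB cA cB] := SB A SA.
  rewrite inE; apply/existsP; exists A; apply/existsP; exists (B A).
  by rewrite sAB cA cB !eqxx.
apply/trivIsetP=> _ _ /imsetP[A SA ->] /imsetP[A' SA' ->].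
apply: contraR => /pred0Pn[X /andP[XA XA']].
by rewrite (meet A A' X).
Qed.

(** * Parenthesis matching *)

(** The number of brackets open just before position j; truncated subtraction
    makes a closing point with nothing to close have no effect. *)
Fixpoint backlog (k : nat) (a : pred nat) (j : nat) : nat :=
  if j is i.+1 then
    if a i then backlog k a i + k else (backlog k a i).-1
  else 0.

Definition free k (a : pred nat) j := ~~ a j && (backlog k a j == 0).

(** Every position opens k brackets, closes one, or is free. *)
Lemma sum_free k a j :
  backlog k a j + j = k.+1 * (\sum_(i < j) a i) + \sum_(i < j) free k a i.
Proof.
elim: j => [|j IHj]; first by rewrite !big_ord0 muln0.
rewrite !big_ord_recr /= {2}/free mulnDr.
move: IHj; set S := \sum_(i < j) a i; set F := \sum_(i < j) _.
case: (a j) => /=; first lia.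
case: (backlog k a j) => [|b] /=; lia.
Qed.

(** Where a and a' agree, their backlogs move in parallel, except that a
    position with no open bracket for a may still close one for a'. *)
Lemma backlog_surplus k a a' i j :
    i <= j -> (forall z, i <= z < j -> a z = a' z) ->
  backlog k a j + backlog k a' i <=
  backlog k a' j + backlog k a i + \sum_(i <= z < j) free k a z.
Proof.
move=> leij; rewrite -(subnKC leij); elim: (j - i) => [|d IHd] eqa.
  by rewrite addn0; lia.
rewrite addnS big_nat_recr ?leq_addr //=.
have eqd : a (i + d) = a' (i + d) by apply: eqa; lia.
have {}IHd := IHd (fun z iz => eqa z ltac:(lia)).
rewrite -eqd {2}/free; case: (a (i + d)) => /=; first lia.
by case: (backlog k a (i + d)) IHd => [|b] /=; lia.
Qed.

(** * The last free points *)

Definition final_in n (F E : {set 'I_n}) :=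
  forall e y : 'I_n, e \in E -> y \in F -> e < y -> y \in E.

Lemma exists_final n k (F : {set 'I_n}) :
  k <= #|F| -> exists E : {set 'I_n}, [/\ E \subset F, #|E| = k & final_in n F E].
Proof.
elim: k F => [|k IHk] F.
  by move=> _; exists set0; rewrite sub0set cards0; split=> // e y; rewrite inE.
move=> ltkF; have /card_gt0P[x0 Fx0] : 0 < #|F| by lia.
pose x := [arg max_(i > x0 | i \in F) val i].
have [Fx maxx] : x \in F /\ forall y, y \in F -> y <= x.
  by rewrite /x; case: arg_maxnP.
have cF := cardsD1 x F; rewrite Fx in cF.
have [|E [sE cE fE]] := IHk (F :\ x); first lia.
exists (x |: E); split.
- by rewrite subUset sub1set Fx (subset_trans sE) ?subsetDl.
- rewrite cardsU1 cE; case xE : (x \in E) => //.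
  by have := subsetP sE x xE; rewrite !inE eqxx.
- move=> e y; rewrite !inE => /orP[/eqP->|Ee] Fy lt_y.
    by have := maxx y Fy; lia.
  by case: eqVneq => //= neq; apply: (fE e) => //; rewrite !inE neq.
Qed.

(** The matching recurses over all natural positions, hence this form of
    membership, false from n on. *)
Definition nat_mem n (A : {set 'I_n}) : pred nat :=
  fun j => j \in [seq val i | i in A].

Lemma nat_memE n (A : {set 'I_n}) (i : 'I_n) : nat_mem n A i = (i \in A).
Proof. by rewrite /nat_mem; apply: (mem_image val_inj). Qed.

Definition free_set n k m (A : {set 'I_n}) : {set 'I_n} :=
  [set i : 'I_n | (i < m) && free k (nat_mem n A) i].

Definition initial n m : {set 'I_n} := [set i : 'I_n | i < m].

Lemma sum_nat_card n (P : pred nat) i j :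
  j <= n -> \sum_(i <= z < j) P z = #|[set z : 'I_n | (i <= z < j) && P z]|.
Proof.
move=> lejn.
rewrite big_geq_mkord (big_ord_widen_cond n (fun z => i <= z) (fun z => P z : nat)) //.
rewrite -sum1dep_card [RHS]big_mkcondr /=.
by apply: eq_bigr => z _; case: (P z).
Qed.

Lemma card_initial n m : m <= n -> #|initial n m| = m.
Proof.
move=> lemn; have := sum_nat_card n predT 0 m lemn.
rewrite sum_nat_const_nat subn0 muln1 => {2}->.
by apply: eq_card => z; rewrite !inE andbT.
Qed.

(** This is [sum_free] at m, with the brackets still open there discarded. *)
Lemma card_free_set n k m (A : {set 'I_n}) :
  m <= n -> A \subset initial n m -> m <= k.+1 * #|A| + #|free_set n k m A|.
Proof.
move=> lemn /subsetP sA.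
have := sum_free k (nat_mem n A) m.
have conv (P : pred nat) : \sum_(i < m) P i = #|[set z : 'I_n | (z < m) && P z]|.
  by rewrite -(sum_nat_card n P 0) // big_mkord.
rewrite !conv.
set A1 := [set z | _];
have -> : A1 = A.
  apply/setP=> z; rewrite inE nat_memE; case Az: (z \in A); last by rewrite andbF.
  by have := sA z Az; rewrite inE => ->.
by rewrite -/(free_set n k m A) => <-; rewrite leq_addl.
Qed.

(** * Disjointness *)

Definition last_free n k m (A E : {set 'I_n}) :=
  [/\ E \subset free_set n k m A, #|E| = k & final_in n (free_set n k m A) E].

(** Only the relative order of the two points breaks the symmetry between A and
    A'; the induction on their distance makes them consecutive in the symmetric
    difference. *)
Lemma no_crossing n k m (A A' E E' : {set 'I_n}) (e x : 'I_n) :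
    last_free n k m A E -> last_free n k m A' E' ->
    A' :\: A \subset E -> A :\: A' \subset E' ->
    e \in A' :\: A -> x \in A :\: A' -> e < x -> False.
Proof.
move=> [sE cE fE] [sE' _ _] /subsetP sA'E /subsetP sAE'.
have [d] := ubnP (x - e); elim: d => // d IHd in e x * => ltd eD xD lt_ex.
case: (pickP [pred z : 'I_n | (e < z < x) && ((z \in A) != (z \in A'))]).
  move=> z /= /andP[/andP[ltez ltzx]].
  case Az: (z \in A); case A'z: (z \in A') => // _.
    by apply: (IHd e z) => //; rewrite ?inE ?Az ?A'z //; lia.
  by apply: (IHd z x) => //; rewrite ?inE ?Az ?A'z //; lia.
move=> agree.
have Ee := sA'E e eD.
have := subsetP sE e Ee; rewrite inE => /andP[ltem /andP[_ /eqP backe]].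
have := subsetP sE' x (sAE' x xD); rewrite inE => /andP[ltxm /andP[_ /eqP backx]].
move: eD xD; rewrite !inE => /andP[nAe A'e] /andP[nA'x Ax].
have eqA z : e.+1 <= z < x -> nat_mem n A z = nat_mem n A' z.
  move=> ezx; have ltzn : z < n by have := ltn_ord x; lia.
  have /= := agree (Ordinal ltzn); rewrite ezx /= => /negbFE/eqP.
  by rewrite -!nat_memE.
have /= := backlog_surplus k _ _ _ _ lt_ex eqA.
rewrite !nat_memE (negbTE nAe) A'e backe backx (sum_nat_card n) ?(ltnW (ltn_ord x)) //.
set G := [set z | _].
have sG : G \subset E :\ e.
  apply/subsetP=> z; rewrite !inE => /andP[/andP[ltez ltzx] fz].
  have -> /= : z != e by apply: contraTneq ltez => ->; rewrite ltnn.
  by apply: (fE e) => //; rewrite inE fz andbT; lia.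
(* As e itself is in E, fewer than k free points of A lie between e and x. *)
have := subset_leq_card sG; have := cardsD1 e E; rewrite Ee cE.
by move: #|G| #|E :\ e| => g h /=; lia.
Qed.

Lemma eq_of_mutual_sub n k m (A A' E E' : {set 'I_n}) :
    #|A| = #|A'| -> last_free n k m A E -> last_free n k m A' E' ->
    A' :\: A \subset E -> A :\: A' \subset E' -> A = A'.
Proof.
move=> eqc lE lE' sA'E sAE'.
case: (set_0Vmem (A :\: A')) => [/eqP|[x xD]].
  by rewrite setD_eq0 => sAA'; apply/eqP; rewrite eqEcard sAA' eqc leqnn.
case: (set_0Vmem (A' :\: A)) => [/eqP|[e eD]].
  by rewrite setD_eq0 => sA'A; apply/esym/eqP; rewrite eqEcard sA'A eqc leqnn.
case: (ltngtP e x) => [lt_ex|lt_xe|/val_inj eq_ex].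
- by case: (no_crossing _ _ _ _ _ _ _ _ _ lE lE' sA'E sAE' eD xD lt_ex).
- by case: (no_crossing _ _ _ _ _ _ _ _ _ lE' lE sAE' sA'E xD eD lt_xe).
- by move: eD xD; rewrite eq_ex !inE => /andP[/negbTE->]; rewrite andbF.
Qed.

Theorem corollary4p1 (p q n : nat) (hp : 0 < p) (hq : 0 < q)
    (hn : p + q + q %/ p <= n) :
  'C(p + q + q %/ p, p) <= nu n p (n - q).
Proof.
set k := q %/ p in hn *; set m := p + q + k in hn *.
have lekp : k * p <= q by apply: leq_divM.
pose S := [set A : {set 'I_n} | (A \subset initial n m) && (#|A| == p)].
have exE A : exists E, A \in S -> last_free n k m A E.
  case SA: (A \in S); last by exists set0.
  move: SA; rewrite inE => /andP[sA /eqP cA].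
  have [|E lE] := exists_final n k (free_set n k m A); last by exists E.
  by have := card_free_set n k m A hn sA; rewrite cA /m; nia.
have [E lE] := fin_all_exists exE.
have E_initial A : A \in S -> E A \subset initial n m.
  case/lE=> sE _ _; apply: subset_trans sE _.
  by apply/subsetP=> z; rewrite !inE => /andP[].
pose B A := A :|: E A :|: ~: initial n m.
have diff A A' : A \in S -> A \subset B A' -> A :\: A' \subset E A'.
  rewrite inE => /andP[/subsetP sA _] /subsetP sAB; apply/subsetP=> z.
  rewrite in_setD => /andP[nA'z Az]; have := sAB z Az; have := sA z Az.
  by rewrite !in_setU in_setC (negbTE nA'z) => ->; rewrite orbF.
rewrite -[X in 'C(X, p)](card_initial n m hn) -cards_draws -/S.
apply: (card_le_nu n p (n - q) S B) => [A SA|A A' SA SA' sAB sA'B].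
  have [sE cE _] := lE A SA.
  have := SA; rewrite inE => /andP[sA /eqP cA].
  split=> //; first by rewrite /B -setUA subsetUl.
  have AE0 : A :&: E A = set0.
    apply/setP=> z; rewrite !inE; apply/negP=> /andP[Az /(subsetP sE)].
    by rewrite inE /free nat_memE Az andbF.
  have tail0 : (A :|: E A) :&: ~: initial n m = set0.
    by apply/eqP; rewrite -setDE setD_eq0 subUset sA E_initial.
  rewrite /B cardsU tail0 cardsU AE0 cards0 !subn0 cA cE.
  by have := cardsC (initial n m); rewrite card_initial // card_ord /m; lia.
have card_S X : X \in S -> #|X| = p by rewrite inE => /andP[_ /eqP].
apply: (eq_of_mutual_sub n k m _ _ (E A) (E A')).
- by rewrite !card_S.
- exact: lE.
- exact: lE.
- exact: diff.
- exact: diff.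
Qed.
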